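(* Let $Z=\sum_{i=1}^n m_iP_i$ be a fat point scheme in $\mathbb{P}^N$, where $P_1,\ldots,P_n$ are distinct collinear points in $\mathbb{P}^N$ and $m_1,\dots,m_n$ are non-negative integers, not all zero. Then $I(Z)^{(m)}=I(Z)^m$ for all $m\in\mathbb{N}$, and thus $\rho(I(Z))=1$.
   Context: $\mathbb{K}$ is an algebraically closed field of any characteristic, $N\ge 2$, and $R=\mathbb{K}[x_0,\ldots,x_N]$ is the homogeneous coordinate ring of $\mathbb{P}^N$. For a point $P$, $I(P)\subseteq R$ is the ideal generated by all forms vanishing at $P$. For distinct points $P_1,\dots,P_n$ and non-negative integers $m_i$, the fat point scheme $Z=\sum_i m_iP_i$ has ideal $I(Z)=\bigcap_i I(P_i)^{m_i}$ (with $I(P)^0=R$). The $m$-th symbolic power of $I(Z)$ is $I(Z)^{(m)}=\bigcap_i I(P_i)^{mm_i}$. For a non-zero proper homogeneous ideal $I$ of this type, the resurgence is $\rho(I)=\sup\{m/r : I^{(m)}\not\subseteq I^r\}$, with $m,r$ ranging over positive integers. *)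

(* Defs.v *)
From mathcomp Require Import all_boot all_order all_algebra.
From mathcomp Require Import mpoly.
From mathcomp Require Import classical_sets reals constructive_ereal ereal.

Set Implicit Arguments.
Unset Strict Implicit.
Unset Printing Implicit Defensive.

Import GRing.Theory.
Local Open Scope classical_set_scope.
Local Open Scope ring_scope.

Section Ideals.
Variable A : comNzRingType.

(* The whole ring counts as an ideal here; MathComp's [idealr_closed] would
   exclude it. *)
Definition is_ideal (J : set A) : Prop :=
  [/\ J 0,
      forall f g, J f -> J g -> J (f + g) &
      forall a f, J f -> J (a * f)].

Definition ideal_gen (S : set A) : set A := smallest is_ideal S.

Definition ideal_mul (I J : set A) : set A :=
  ideal_gen [set h | exists f g, [/\ I f, J g & h = f * g]].

Definition ideal_pow (I : set A) (r : nat) : set A :=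
  iter r (ideal_mul I) setT.

End Ideals.

Section Projective.
Variables (K : fieldType) (N : nat).

(* Points of P^N as one-dimensional subspaces of K^(N+1), so that equality of
   points is Leibniz equality. *)
Definition ppoint := {V : {vspace 'rV[K]_N.+1} | \dim V == 1%N}.

(* A line of P^N is a two-dimensional subspace of K^(N+1). *)
Definition collinear (n : nat) (P : 'I_n -> ppoint) : Prop :=
  exists L : {vspace 'rV[K]_N.+1},
    \dim L = 2%N /\ forall i, (val (P i) <= L)%VS.

Definition vanishes_at (f : {mpoly K[N.+1]}) (p : ppoint) : Prop :=
  forall v : 'rV[K]_N.+1, v \in val p -> f.@[fun j => v 0 j] = 0.

Definition point_ideal (p : ppoint) : set {mpoly K[N.+1]} :=
  ideal_gen [set f | (exists d : nat, f \is d.-homog) /\ vanishes_at f p].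

(* I(Z) for the fat point scheme Z = \sum_i mult i * P i. *)
Definition fat_ideal (n : nat) (P : 'I_n -> ppoint) (mult : 'I_n -> nat) :
    set {mpoly K[N.+1]} :=
  \bigcap_i ideal_pow (point_ideal (P i)) (mult i).

(* The m-th symbolic power I(Z)^(m). *)
Definition fat_symbolic (n : nat) (P : 'I_n -> ppoint) (mult : 'I_n -> nat)
    (m : nat) : set {mpoly K[N.+1]} :=
  \bigcap_i ideal_pow (point_ideal (P i)) (m * mult i)%N.

(* rho(I(Z)); the supremum is taken in the extended reals, so that an unbounded
   set of ratios has supremum +oo rather than a default value. *)
Definition resurgence (R : realType) (n : nat) (P : 'I_n -> ppoint)
    (mult : 'I_n -> nat) : \bar R :=
  ereal_sup [set x : \bar R | exists m r : nat,
    [/\ (0 < m)%N, (0 < r)%N,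
        ~ (fat_symbolic P mult m `<=` ideal_pow (fat_ideal P mult) r) &
        x = (m%:R / r%:R)%:E]].

End Projective.

(* Main.v *)
(* Choose a basis u, w of the plane over the line so that P_i = <a_i u + w>, with
   s, t the dual linear forms and y the forms vanishing on the line. Writing a
   polynomial as \sum_b c_b(s, t) y^b, membership in I(P_i)^k means that
   (s - a_i t)^(k - |b|) divides c_b for every b. The forms s - a_i t are pairwise
   coprime, so I(Z)^(m) is spanned over K[s, t] by the products
   \prod_i (s - a_i t)^(m m_i - |b|) y^b (truncated subtraction). Splitting y^b
   into m parts of degrees as equal as possible writes each such product as a
   multiple of a product of m generators of I(Z), because then, for each i, all the
   m_i - |b_j| have the sign of m m_i - |b|. For the resurgence, I(Z)^m being
   contained in I(Z)^(m+1) would put I(Z)^m inside all powers of I(Z), whose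
   intersection is zero. *)
Require Import Defs.
From mathcomp Require Import all_boot all_order all_algebra.
From mathcomp Require Import mpoly.
From mathcomp Require Import classical_sets reals constructive_ereal ereal.
From mathcomp Require Import zify ring lra.

Local Open Scope ring_scope.

Section CollinearFatPoints.
Set Implicit Arguments.
Unset Strict Implicit.
Unset Printing Implicit Defensive.
Import GRing.Theory.

(** * Products and powers of ideals *)

Section Ideals.
Local Open Scope classical_set_scope.
Variable A : comNzRingType.
Implicit Types I J : set A.

Lemma ideal_gen_ideal (S : set A) : is_ideal (ideal_gen S).
Proof.
split=> [J [[]] //|f g Sf Sg J JS|a f Sf J JS].
  by have [[_ JD _] _] := JS; apply: JD; [apply: Sf | apply: Sg].
by have [[_ _ JM] _] := JS; apply: JM; apply: Sf.
Qed.

Lemma ideal_gen_min (S J : set A) : is_ideal J -> S `<=` J -> ideal_gen S `<=` J.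
Proof. by move=> idJ SJ; apply: smallest_sub. Qed.

Lemma ideal_mulM I J f g : I f -> J g -> ideal_mul I J (f * g).
Proof. by move=> If Jg L [_]; apply; exists f, g. Qed.

Lemma ideal_mul_min I J L : is_ideal L ->
  (forall f g, I f -> J g -> L (f * g)) -> ideal_mul I J `<=` L.
Proof.
by move=> idL IJL; apply: ideal_gen_min => // _ [f [g [If Jg ->]]]; apply: IJL.
Qed.

Lemma is_ideal_sum I (T : Type) (r : seq T) (p : pred T) (F : T -> A) :
  is_ideal I -> (forall i, p i -> I (F i)) -> I (\sum_(i <- r | p i) F i).
Proof. by case=> I0 ID _ IF; elim/big_ind: _. Qed.

Lemma is_ideal_setT : is_ideal (@setT A).
Proof. by []. Qed.

Lemma ideal_pow_ideal I k : is_ideal (ideal_pow I k).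
Proof. by case: k => [|k]; [apply: is_ideal_setT | apply: ideal_gen_ideal]. Qed.

Lemma ideal_powM I j k f g :
  ideal_pow I j f -> ideal_pow I k g -> ideal_pow I (j + k) (f * g).
Proof.
move=> + Ig; elim: j f => [|j IH] f If.
  by case: (ideal_pow_ideal I k) => _ _; apply.
case: (ideal_pow_ideal I (j.+1 + k)) => L0 LD LM.
(* The colon ideal of [g] into the target power: being an ideal, it only has to contain the
   generating products. *)
pose L : set A := [set h | ideal_pow I (j.+1 + k) (h * g)].
suff: L f by [].
move: f If; apply: ideal_mul_min => [|f h If Ih].
  split=> [|f h|a f]; rewrite /L /= ?mul0r ?mulrDl -?mulrA //; first exact: LD.
  exact: LM.
by rewrite /L /= -mulrA; apply: ideal_mulM => //; apply: IH.
Qed.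

Lemma ideal_powX I f k : I f -> ideal_pow I k (f ^+ k).
Proof. by move=> If; elim: k => // k IH; rewrite exprS; apply: ideal_mulM. Qed.

Lemma ideal_pow_le I j k : (j <= k)%N -> ideal_pow I k `<=` ideal_pow I j.
Proof.
move=> /subnK <-; elim: (k - j)%N => // d IH.
apply: ideal_mul_min; first exact: ideal_pow_ideal.
by move=> f g _ /IH; case: (ideal_pow_ideal I j) => _ _; apply.
Qed.

Lemma ideal_powS I J k : I `<=` J -> ideal_pow I k `<=` ideal_pow J k.
Proof.
move=> IJ; elim: k => // k IH; apply: ideal_mul_min; first exact: ideal_pow_ideal.
by move=> f g /IJ Jf /IH Jg; apply: ideal_mulM.
Qed.

Lemma ideal_powXM I j k : ideal_pow (ideal_pow I j) k `<=` ideal_pow I (k * j).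
Proof.
elim: k => // k IH; apply: ideal_mul_min; first exact: ideal_pow_ideal.
by move=> f g If /IH Ig; rewrite mulSn; apply: ideal_powM.
Qed.

Lemma ideal_pow_stable I m : ideal_pow I m `<=` ideal_pow I m.+1 ->
  forall k, ideal_pow I m `<=` ideal_pow I k.
Proof.
move=> sub k; have [le_km|/ltnW le_mk] := leqP k m; first exact: ideal_pow_le.
have step d : ideal_pow I (d + m) `<=` ideal_pow I (d + m).+1.
  elim: d => // d IH; apply: ideal_mul_min; first exact: ideal_pow_ideal.
  by move=> f g If /IH; apply: ideal_mulM.
by rewrite -(subnK le_mk); elim: (k - m)%N => // d IH f /IH /step.
Qed.

(** The powers of [I] form the smallest multiplicative filtration whose first step contains [I], so
    order conditions need checking only on [I] itself. *)
Lemma ideal_pow_filtered I (Q : nat -> set A) :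
  (forall k, is_ideal (Q k)) -> Q 0%N = setT ->
  (forall j k f g, Q j f -> Q k g -> Q (j + k)%N (f * g)) ->
  I `<=` Q 1%N -> forall k, ideal_pow I k `<=` Q k.
Proof.
move=> idQ Q0 QM IQ; elim=> [|k IH]; first by rewrite Q0.
by apply: ideal_mul_min => // f g /IQ Qf /IH; apply: (QM 1%N).
Qed.

End Ideals.

(** * Divisibility by powers of linear factors *)

Section Divisibility.
Variables (D : idomainType).

(* By the factor theorem ['X - a] is prime in [{poly D}]. *)
Lemma XsubC_exp_dvd_cancel (a : D) (e : nat) (p f g : {poly D}) :
  p.[a] != 0 -> p * f = g * ('X - a%:P) ^+ e ->
  exists h : {poly D}, f = h * ('X - a%:P) ^+ e.
Proof.
move=> pa; elim: e f g => [|e IH] f g eq_pf; first by exists f; rewrite mulr1.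
have /factor_theorem[f' def_f]: root f a.
  have := congr1 (horner^~ a) eq_pf.
  rewrite exprSr mulrA !hornerM hornerXsubC subrr mulr0 => /eqP.
  by rewrite mulf_eq0 (negPf pa).
have [|h def_h] := IH f' g.
  have /mulIf: 'X - a%:P != 0 by rewrite polyXsubC_eq0.
  by apply; rewrite -mulrA -def_f eq_pf exprSr mulrA.
by exists h; rewrite def_f def_h exprSr mulrA.
Qed.

(** The factors already collected do not vanish at the new root [a i], so the power of ['X - a i]
    must divide the cofactor [g]. *)
Lemma XsubC_prod_dvd (T : eqType) (r : seq T) (a : T -> D) (e : T -> nat)
    (f : {poly D}) :
  injective a -> uniq r ->
  (forall i, exists g : {poly D}, f = g * ('X - (a i)%:P) ^+ e i) ->
  exists g : {poly D}, f = g * \prod_(i <- r) ('X - (a i)%:P) ^+ e i.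
Proof.
move=> inj_a + dvd_f; elim: r => [|i r IH] /=.
  by exists f; rewrite big_nil mulr1.
case/andP=> r'i /IH[g def_f]; have [h def_f'] := dvd_f i.
have [||k def_g] := @XsubC_exp_dvd_cancel (a i) (e i)
    (\prod_(j <- r) ('X - (a j)%:P) ^+ e j) g h.
- rewrite horner_prod prodf_seq_neq0; apply/allP=> j rj.
  rewrite horner_exp hornerXsubC expf_neq0 // subr_eq0 (inj_eq inj_a).
  by apply: contraNneq r'i => ->.
- by rewrite mulrC -def_f.
by exists k; rewrite def_f def_g big_cons mulrA.
Qed.

Lemma XsubC_exp_dvd_all (a : D) (f : {poly D}) :
  (forall k, exists g : {poly D}, f = g * ('X - a%:P) ^+ k) -> f = 0.
Proof.
move=> dvd_f; apply/eqP; apply: contraT => f0.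
have [g def_f] := dvd_f (size f).
have g0 : g != 0 by apply: contraNneq f0 => g0; rewrite def_f g0 mul0r.
have := congr1 (size : {poly D} -> nat) def_f.
rewrite size_Mmonic ?rpredX ?monicXsubC // size_exp_XsubC.
by have := size_poly_gt0 g; rewrite g0; lia.
Qed.

End Divisibility.

(** * The order filtration at a point of the line *)

Section Filtration.
Local Open Scope classical_set_scope.
Variables (A C : comNzRingType) (d : nat) (phi : {rmorphism A -> {mpoly C[d]}}).
Variable l : C.

(* The preimage under [phi] of the [k]-th power of the ideal generated by [l]
   and the variables. *)
Definition filtered_ideal (k : nat) : set A :=
  [set f | forall b, exists g, (phi f)@_b = g * l ^+ (k - mdeg b)].

Lemma filtered_ideal_ideal k : is_ideal (filtered_ideal k).
Proof.
have dvdW (j j' : nat) c : (j' <= j)%N ->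
    (exists g, c = g * l ^+ j) -> exists g, c = g * l ^+ j'.
  move=> /subnK {1}<- [g ->]; exists (g * l ^+ (j - j')).
  by rewrite exprD mulrA.
split=> [b|f g Ff Fg b|a f Ff b].
- by exists 0; rewrite rmorph0 mcoeff0 mul0r.
- have [[f' ef] [g' eg]] := (Ff b, Fg b).
  by exists (f' + g'); rewrite rmorphD mcoeffD ef eg mulrDl.
rewrite rmorphM mcoeffM; elim/big_ind: _ => [|x y [x' ->] [y' ->]|].
- by exists 0; rewrite mul0r.
- by exists (x' + y'); rewrite mulrDl.
case=> b1 b2 /eqP def_b; have /= [g ->] := Ff b2.
(* As |b2| <= |b|, the coefficient of [f] carries at least the required power of [l]; the surplus
   goes into the cofactor. *)
exists ((phi a)@_b1 * g * l ^+ (k - mdeg b2 - (k - mdeg b))).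
rewrite -!mulrA -exprD subnK //.
by have := congr1 mdeg def_b; rewrite /= mdegD; lia.
Qed.

Lemma filtered_idealM j k f g :
  filtered_ideal j f -> filtered_ideal k g -> filtered_ideal (j + k) (f * g).
Proof.
move=> Ff Fg b.
rewrite rmorphM mcoeffM; elim/big_ind: _ => [|x y [x' ->] [y' ->]|].
- by exists 0; rewrite mul0r.
- by exists (x' + y'); rewrite mulrDl.
case=> b1 b2 /eqP def_b; have /= [[f' ->] [g' ->]] := (Ff b1, Fg b2).
set e := (j + k - _)%N.
exists (f' * g' * l ^+ ((j - mdeg b1) + (k - mdeg b2) - e)).
rewrite mulrACA -!mulrA -!exprD subnK // /e.
by have := congr1 mdeg def_b; rewrite /= mdegD; lia.
Qed.

Lemma filtered_ideal0 : filtered_ideal 0 = setT.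
Proof. by apply/seteqP; split=> // f _ b; exists (phi f)@_b; rewrite mulr1. Qed.

End Filtration.

(** * Coordinates adapted to the line *)

Section LineCoordinates.
Variables (K : closedFieldType) (N : nat).

Lemma collinear_coordinates (n : nat) (P : 'I_n -> ppoint K N) :
    injective P -> collinear P ->
  exists (u w : 'rV[K]_N.+1) (a : 'I_n -> K) (l0 l1 : 'rV[K]_N.+1),
  [/\ injective a, forall i, val (P i) = <[a i *: u + w]>%VS,
      \sum_j l0 0 j * u 0 j = 1 /\ \sum_j l0 0 j * w 0 j = 0 &
      \sum_j l1 0 j * u 0 j = 0 /\ \sum_j l1 0 j * w 0 j = 1].
Proof.
move=> injP [L [dimL PL]].
have [e basL] : {e : 2.-tuple 'rV[K]_N.+1 | basis_of L e}.
  by move: (vbasisP L); rewrite -dimL; exists (vbasis L).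
have freeL := basis_free basL.
pose x (v : 'rV[K]_N.+1) : K := coord e 0 v.
pose y (v : 'rV[K]_N.+1) : K := coord e 1 v.
have xyE v : v \in L -> v = x v *: e`_0 + y v *: e`_1.
  move=> /(coord_basis basL) {1}->; rewrite big_ord_recl big_ord1.
  by rewrite /x /y; congr (coord e _ v *: _ + coord e _ v *: _); apply: val_inj.
have pE i : {v : 'rV[K]_N.+1 | v != 0 & val (P i) = <[v]>%VS}.
  have dimP : \dim (val (P i)) = 1%N by apply/eqP: (svalP (P i)).
  exists (vpick (val (P i))); first by rewrite vpick0 -dimv_eq0 dimP.
  apply/esym/eqP; rewrite eqEdim -memvE memv_pick dim_vline vpick0 -dimv_eq0.
  by rewrite dimP.
pose p i := s2val (pE i).
have p0 i : p i != 0 by rewrite /p; case: (pE i).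
have Pp i : val (P i) = <[p i]>%VS by rewrite /p; case: (pE i).
have pL i : p i \in L by rewrite memvE -Pp.
(* [u := e_0 + c e_1] is chosen off all the points, which therefore have a
   nonzero second coordinate in the basis [u, e_1]. *)
have [c c_ok] : exists c, forall i, y (p i) - c * x (p i) != 0.
  have /closed_nonrootP[c]: \prod_i ((y (p i))%:P - (x (p i)) *: 'X) != 0.
    apply/prodf_neq0 => i _; apply: contraNneq (p0 i) => eq0.
    have y0 := congr1 (coefp 0) eq0; have x0 := congr1 (coefp 1) eq0.
    move: x0 y0; rewrite /= !coefB !coefC !coefZ !coefX /=.
    rewrite mulr1 mulr0 subr0 sub0r => /eqP; rewrite oppr_eq0 => /eqP x0 y0.
    by rewrite (xyE _ (pL i)) x0 y0 !scale0r addr0.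
  rewrite /root horner_prod => /prodf_neq0 nz; exists c => i.
  by have := nz i isT; rewrite !hornerE mulrC.
pose z i := y (p i) - c * x (p i).
pose u := e`_0 + c *: e`_1.
pose a i := x (p i) / z i.
have Pa i : val (P i) = <[a i *: u + e`_1]>%VS.
  have -> : a i *: u + e`_1 = (z i)^-1 *: p i.
    rewrite [in RHS](xyE _ (pL i)) /u /a scalerDr !scalerA scalerDr !scalerA.
    rewrite -addrA [x (p i) / _]mulrC -[X in _ + (_ + X)]scale1r -scalerDl.
    have -> // : (z i)^-1 * x (p i) * c + 1 = (z i)^-1 * y (p i).
    rewrite -(mulVf (c_ok i : z i != 0)) -mulrA -mulrDr /z mulrC.
    by rewrite [c * _]mulrC [_ * c + _]addrC subrK mulrC.
  apply/eqP; rewrite Pp eqEsubv -!memvE; apply/andP; split; apply/vlineP.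
    by exists (z i); rewrite scalerA mulfV ?scale1r //; apply: c_ok.
  by exists (z i)^-1.
(* [coord e k] is linear on the whole space; [row k] lists its coefficients. *)
pose row (k : 'I_2) : 'rV[K]_N.+1 :=
  \row_j coord e k (delta_mx 0 j : 'rV[K]_N.+1).
have rowE k (v : 'rV[K]_N.+1) : \sum_j row k 0 j * v 0 j = coord e k v.
  rewrite [in RHS](row_sum_delta v) linear_sum; apply: eq_bigr => j _.
  by rewrite linearZ /= mxE mulrC.
have [x0 x1] : x e`_0 = 1 /\ x e`_1 = 0.
  by rewrite /x (coord_free 0 0) // (coord_free 1 0).
have [y0 y1] : y e`_0 = 0 /\ y e`_1 = 1.
  by rewrite /y (coord_free 0 1) // (coord_free 1 1).
have xfold v : coord e 0 v = x v by [].
have yfold v : coord e 1 v = y v by [].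
(* On the plane, x e_0 + y e_1 = x u + (y - c x) e_1, so this is the second coordinate in the basis
   (u, e_1). *)
have row1E (v : 'rV[K]_N.+1) :
    \sum_j (row 1 - c *: row 0) 0 j * v 0 j = y v - c * x v.
  rewrite /x /y -!rowE mulr_sumr -sumrB; apply: eq_bigr => j _.
  by rewrite !mxE; ring.
exists u, e`_1, a, (row 0), (row 1 - c *: row 0); split=> //.
- move=> i j eq_a; apply/injP/val_inj.
  by move: (Pa i) (Pa j); rewrite eq_a => <-.
- by rewrite !rowE /u linearD linearZ /= !xfold x0 x1 mulr0 addr0.
rewrite !row1E {1 2}/u {1}/x {1}/y !linearD !linearZ /=.
by rewrite !xfold !yfold x0 x1 y0 y1; split; ring.
Qed.

End LineCoordinates.

(** * Morphisms, monomials and balanced splitting *)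

Section Multivariate.

Lemma mpoly_rmorph_eq (k : nat) (A B : comNzRingType)
    (F G : {rmorphism {mpoly A[k]} -> B}) :
  (forall c, F c%:MP = G c%:MP) -> (forall j, F 'X_j = G 'X_j) -> F =1 G.
Proof.
move=> eqC eqX f; rewrite (mpolyE f) !rmorph_sum /=; apply: eq_bigr => m _.
rewrite -mul_mpolyC !rmorphM eqC mpolyXE_id !rmorph_prod; congr (_ * _).
by apply: eq_bigr => j _; rewrite !rmorphXn /= eqX.
Qed.

Lemma mnm_split (k : nat) (b : 'X_{1..k}) (q : nat) : (q <= mdeg b)%N ->
  exists b1 b2, b = (b1 + b2)%MM /\ mdeg b1 = q.
Proof.
elim: q => [|q IH] le_q; first by exists 0%MM, b; rewrite add0m mdeg0.
have [b1 [b2 [def_b deg_b1]]] := IH (ltnW le_q).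
have [j b2j] : exists j, b2 j != 0%N.
  apply/existsP; apply: contraTT le_q => /existsPn b2_0.
  suff b20 : b2 = 0%MM by rewrite def_b b20 addm0 deg_b1 ltnn.
  by apply/mnmP => j; rewrite mnm0E; apply/eqP; move: (b2_0 j); rewrite negbK.
exists (b1 + U_(j))%MM, (b2 - U_(j))%MM; rewrite mdegD deg_b1 mdeg1 addn1.
split=> //; rewrite def_b -addmA; congr (_ + _)%MM.
apply/mnmP => i; rewrite mnmDE mnmBE mnm1E.
by case: eqVneq => [<-|_]; move: b2j; lia.
Qed.

(* Removing a share [q = b %/ m.+1] of the [b] residues, the positive parts add
   up exactly because [mu - q] and [m.+1 * mu - b] have the same sign. *)
Lemma balanced_split (m mu b : nat) (q := (b %/ m.+1)%N) :
  ((mu - q) + (m * mu - (b - q)) <= m.+1 * mu - b)%N.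
Proof.
have le1 : (q * m.+1 <= b)%N by apply: leq_trunc_div.
have le2 : (b < q.+1 * m.+1)%N by apply: ltn_ceil.
have [le_mu|lt_mu] := leqP mu q; nia.
Qed.

End Multivariate.

(** * Polynomials in line coordinates *)

Section LinearChange.
Local Open Scope classical_set_scope.
Variables (K : closedFieldType) (N n : nat) (P : 'I_n -> ppoint K N).
Variables (u w : 'rV[K]_N.+1) (a : 'I_n -> K) (l0 l1 : 'rV[K]_N.+1).
Hypothesis inj_a : injective a.
Hypothesis Pa : forall i, val (P i) = <[a i *: u + w]>%VS.
Hypotheses (l0u : \sum_j l0 0 j * u 0 j = 1) (l0w : \sum_j l0 0 j * w 0 j = 0).
Hypotheses (l1u : \sum_j l1 0 j * u 0 j = 0) (l1w : \sum_j l1 0 j * w 0 j = 1).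

Local Notation R := {mpoly K[N.+1]}.
Local Notation C := {poly {poly K}}.
Local Notation T := {mpoly C[N.+1]}.

Definition linear_form (l : 'rV[K]_N.+1) : R := \sum_j l 0 j *: 'X_j.
(** The j-th coordinate of v - l0(v) u - l1(v) w, the part of v left after projection to the
    plane. *)
Definition line_residue (j : 'I_N.+1) : R :=
  'X_j - u 0 j *: linear_form l0 - w 0 j *: linear_form l1.
Definition point_form (i : 'I_n) : R := linear_form l0 - a i *: linear_form l1.

Lemma linear_formE (l v : 'rV[K]_N.+1) :
  (linear_form l).@[fun j => v 0 j] = \sum_j l 0 j * v 0 j.
Proof. by rewrite raddf_sum /=; apply: eq_bigr => j _; rewrite mevalZ mevalXU. Qed.

Lemma linear_form_homog l : linear_form l \is 1.-homog.
Proof. by apply: rpred_sum => j _; rewrite rpredZ // dhomogX /= mdeg1. Qed.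

Lemma linear_formZD (l : 'rV[K]_N.+1) (t b : K) :
  \sum_j l 0 j * (t *: (b *: u + w)) 0 j =
  t * (b * (\sum_j l 0 j * u 0 j) + \sum_j l 0 j * w 0 j).
Proof.
rewrite mulr_sumr -big_split mulr_sumr; apply: eq_bigr => j _.
by rewrite !mxE /=; ring.
Qed.

(* [T] is the coordinate ring [K[t][s][y_0, ..., y_N]] of a larger space: the
   redundant variables [y_j] stand for the [line_residue j], which vanish on the
   line, so that no basis of those forms has to be chosen. *)
Definition to_line : {rmorphism R -> T} :=
  mmap (@mpolyC N.+1 C \o (polyC \o polyC))
    (fun j => ((u 0 j)%:P%:P * 'X + (w 0 j *: 'X)%:P)%:MP + 'X_j).

(** In K[t][s] the outer variable s goes to the form of [l0], the inner variable t to that of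
    [l1]. *)
Definition of_line_coef : {rmorphism C -> R} :=
  horner_eval (linear_form l0) \o
  map_poly (horner_eval (linear_form l1) \o map_poly (@mpolyC N.+1 K)).

Definition of_line : {rmorphism T -> R} := mmap of_line_coef line_residue.

Lemma to_lineX j :
  to_line 'X_j = ((u 0 j)%:P%:P * 'X + (w 0 j *: 'X)%:P)%:MP + 'X_j.
Proof. by rewrite [LHS]mmapX mmap1U. Qed.

Lemma to_lineC c : to_line c%:MP = c%:P%:P%:MP.
Proof. by rewrite [LHS]mmapC. Qed.

Lemma of_line_coefC c : of_line_coef c%:P%:P = c%:MP.
Proof.
by rewrite /of_line_coef /= map_polyC [LHS]hornerC /= map_polyC [LHS]hornerC.
Qed.

Lemma of_line_coefX : of_line_coef 'X = linear_form l0.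
Proof. by rewrite /of_line_coef /= map_polyX [LHS]hornerX. Qed.

Lemma of_line_coefXC : of_line_coef 'X%:P = linear_form l1.
Proof.
by rewrite /of_line_coef /= map_polyC [LHS]hornerC /= map_polyX [LHS]hornerX.
Qed.

Lemma of_lineE p :
  of_line p = \sum_(b <- msupp p) of_line_coef p@_b * mmap1 line_residue b.
Proof. by []. Qed.

Lemma of_lineC c : of_line c%:MP = of_line_coef c.
Proof. by rewrite [LHS]mmapC. Qed.

Lemma of_lineX j : of_line 'X_j = line_residue j.
Proof. by rewrite [LHS]mmapX mmap1U. Qed.

Lemma to_lineK : cancel to_line of_line.
Proof.
apply: (mpoly_rmorph_eq (F := of_line \o to_line) (G := idfun)) => [c|j] /=.
  by rewrite to_lineC of_lineC of_line_coefC.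
rewrite to_lineX rmorphD of_lineC of_lineX rmorphD rmorphM.
rewrite of_line_coefC of_line_coefX -[w 0 j *: 'X]mul_polyC polyCM rmorphM.
rewrite of_line_coefC of_line_coefXC /line_residue !mul_mpolyC; ring.
Qed.

Lemma point_ideal_homog (f : R) d i :
  f \is d.-homog -> vanishes_at f (P i) -> point_ideal (P i) f.
Proof. by move=> homf Pf J [_]; apply; split=> //; exists d. Qed.

Lemma point_ideal_point_form i : point_ideal (P i) (point_form i).
Proof.
apply: (@point_ideal_homog _ 1) => [|v].
  by rewrite rpredB ?rpredZ ?linear_form_homog.
rewrite Pa => /vlineP[c ->].
rewrite mevalB mevalZ !linear_formE !linear_formZD l0u l0w l1u l1w; ring.
Qed.

Lemma point_ideal_line_residue i j : point_ideal (P i) (line_residue j).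
Proof.
apply: (@point_ideal_homog _ 1) => [|v].
  by rewrite !rpredB ?rpredZ ?linear_form_homog // dhomogX /= mdeg1.
rewrite Pa => /vlineP[c ->].
rewrite !mevalB !mevalZ mevalXU !linear_formE !linear_formZD l0u l0w l1u l1w !mxE.
ring.
Qed.

(** It suffices to treat first powers, where only the coefficient at b = 0 is constrained: it has
    the root s = a_i t because [f] vanishes on all multiples of a_i u + w and K is infinite. *)
Lemma point_ideal_filtered i k :
  ideal_pow (point_ideal (P i)) k `<=`
  filtered_ideal to_line ('X - (a i *: 'X)%:P) k.
Proof.
apply: (ideal_pow_filtered (filtered_ideal_ideal _ _)) => [||].
- exact: filtered_ideal0.
- exact: filtered_idealM.
apply: ideal_gen_min; first exact: filtered_ideal_ideal.
move=> f [_ Pf] b; have [->|b0] := eqVneq b 0%MM; last first.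
  exists (to_line f)@_b; move: b0; rewrite -mdeg_eq0 -lt0n => /subnKC.
  by case: (mdeg b) => // d _; rewrite subSS sub0n mulr1.
rewrite mdeg0 expr1; apply/factor_theorem/rootP.
apply: contraTeq isT => /closed_nonrootP[t]; case/negP; apply/rootP.
pose v : 'rV[K]_N.+1 := t *: (a i *: u + w).
(* Setting y = 0, s = a_i t and then giving t a value amounts to evaluation at [v]. *)
pose F : {rmorphism R -> K} :=
  horner_eval t \o horner_eval (a i *: 'X) \o mcoeff 0 \o to_line.
rewrite -[LHS]/(F f) -(Pf v); last by rewrite Pa; apply/vlineP; exists t.
have FE g : F g = ((to_line g)@_0).[a i *: 'X].[t] by [].
apply: mpoly_rmorph_eq => [c|j]; rewrite FE.
  by rewrite [RHS]mevalC to_lineC mcoeffC eqxx mulr1 !hornerC.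
rewrite [RHS]mevalXU to_lineX mcoeffD mcoeffC mcoeffX eqxx.
rewrite mnm1_eq0 addr0 mulr1 !(hornerD, hornerM, hornerC, hornerX, hornerZ).
by rewrite !mxE; ring.
Qed.

(** * Generators of the fat ideal and comparison of powers *)

Variable mult : 'I_n -> nat.

Definition point_form_prod (e : 'I_n -> nat) : R := \prod_i point_form i ^+ e i.

(** At P_i, the i-th point form contributes order [e i] and the residues contribute order |b|. *)
Lemma fat_ideal_term q e b :
  (forall i, mult i <= e i + q)%N -> (q <= mdeg b)%N ->
  fat_ideal P mult (point_form_prod e * mmap1 line_residue b).
Proof.
move=> le_mult le_q i _; apply: (@ideal_pow_le _ _ _ (e i + q)%N) => //.
apply: ideal_powM.
  rewrite /point_form_prod (bigD1 i) //= mulrC.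
  case: (ideal_pow_ideal (point_ideal (P i)) (e i)) => _ _; apply.
  apply: ideal_powX; exact: point_ideal_point_form.
apply: (ideal_pow_le le_q); rewrite /mmap1 mdegE.
elim/big_rec2: _ => // j k y _ IH; apply: ideal_powM IH.
apply: ideal_powX; exact: point_ideal_line_residue.
Qed.

Lemma fat_ideal_pow_term m b e :
  (forall i, m * mult i - mdeg b <= e i)%N ->
  ideal_pow (fat_ideal P mult) m (point_form_prod e * mmap1 line_residue b).
Proof.
elim: m b e => // m IH b e le_e; set q := (mdeg b %/ m.+1)%N.
have [|b1 [b2 [def_b deg_b1]]] := @mnm_split _ b q; first exact: leq_div.
have deg_b : mdeg b = (q + mdeg b2)%N by rewrite def_b mdegD deg_b1.
(* [e1] is the least exponent that, with q residues, gives an element of I(Z); [e2] leaves the rest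
   for the induction. *)
pose e1 i := (mult i - q)%N; pose e2 i := (e i - e1 i)%N.
have le_e12 i : (e1 i + (m * mult i - mdeg b2) <= e i)%N.
  apply: leq_trans (le_e i); have -> : mdeg b2 = (mdeg b - q)%N by lia.
  exact: balanced_split.
have -> : point_form_prod e * mmap1 line_residue b =
    (point_form_prod e1 * mmap1 line_residue b1) *
    (point_form_prod e2 * mmap1 line_residue b2).
  rewrite mulrACA def_b commr_mmap1_M; last by move=> *; apply: mulrC.
  congr (_ * _); rewrite -big_split; apply: eq_bigr => i _ /=.
  by rewrite -exprD subnKC // (leq_trans (leq_addr _ _) (le_e12 i)).
apply: ideal_mulM.
  apply: (@fat_ideal_term q); last by rewrite deg_b1.
  by move=> i; rewrite /e1; lia.
by apply: IH => i; have := le_e12 i; rewrite /e2; lia.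
Qed.

Lemma fat_symbolic_coef_dvd m f b : fat_symbolic P mult m f ->
  exists g : C, (to_line f)@_b =
    g * \prod_i ('X - (a i *: 'X)%:P) ^+ (m * mult i - mdeg b).
Proof.
move=> symf.
(* The roots in s are the polynomials a_i t, told apart by their coefficient of t. *)
have inj_aX : injective (fun i => a i *: 'X : {poly K}).
  move=> i j /(congr1 (fun p : {poly K} => p`_1)).
  by rewrite !coefZ coefX !mulr1; apply: inj_a.
apply: (XsubC_prod_dvd inj_aX (index_enum_uniq _)) => i.
exact: (point_ideal_filtered (symf i I)).
Qed.

Lemma of_line_coef_prod e :
  of_line_coef (\prod_i ('X - (a i *: 'X)%:P) ^+ e i) = point_form_prod e.
Proof.
rewrite rmorph_prod; apply: eq_bigr => i _; rewrite rmorphXn rmorphB.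
rewrite -[a i *: 'X]mul_polyC polyCM rmorphM of_line_coefC of_line_coefX.
by rewrite of_line_coefXC mul_mpolyC.
Qed.

Lemma fat_symbolic_sub_pow m :
  fat_symbolic P mult m `<=` ideal_pow (fat_ideal P mult) m.
Proof.
move=> f symf; rewrite -(to_lineK f) of_lineE.
have idI := ideal_pow_ideal (fat_ideal P mult) m.
apply: is_ideal_sum => // b _.
have [g ->] := fat_symbolic_coef_dvd b symf.
rewrite rmorphM of_line_coef_prod -mulrA; case: idI => _ _; apply.
exact: fat_ideal_pow_term.
Qed.

Lemma fat_pow_sub_symbolic m :
  ideal_pow (fat_ideal P mult) m `<=` fat_symbolic P mult m.
Proof.
move=> f If i _; apply: ideal_powXM; apply: ideal_powS If => g; exact.
Qed.

Lemma fat_symbolicE m : fat_symbolic P mult m = ideal_pow (fat_ideal P mult) m.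
Proof.
apply/seteqP; split; first exact: fat_symbolic_sub_pow.
exact: fat_pow_sub_symbolic.
Qed.

Lemma fat_ideal_pow_neq m : (exists i, mult i <> 0%N) ->
  ~ (ideal_pow (fat_ideal P mult) m `<=` ideal_pow (fat_ideal P mult) m.+1).
Proof.
case=> i /eqP mi sub; pose f := point_form_prod (fun i => m * mult i)%N.
have If : ideal_pow (fat_ideal P mult) m f.
  have := @fat_ideal_pow_term m 0%MM (fun i => m * mult i)%N.
  by rewrite mmap11 mulr1; apply=> j; rewrite leq_subr.
have f_neq0 : f != 0.
  apply/prodf_neq0 => j _; apply: expf_neq0.
  (* Each point form takes the value 1 at [u]. *)
  apply/eqP => /(congr1 (meval (fun k => u 0 k))); rewrite meval0 mevalB mevalZ.
  rewrite !linear_formE l0u l1u mulr0 subr0; apply/eqP; exact: oner_neq0.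
case/eqP: f_neq0; rewrite -(to_lineK f).
suff -> : to_line f = 0 by rewrite rmorph0.
apply/mpolyP => b; rewrite mcoeff0.
apply: (@XsubC_exp_dvd_all _ (a i *: 'X)) => k.
(* The power k + |b| is large enough: (k + |b|) m_i - |b| >= k since m_i > 0, so every power of s -
   a_i t divides the coefficient at b. *)
have := ideal_pow_stable sub (k + mdeg b) If.
move/fat_pow_sub_symbolic/(_ i I)/point_ideal_filtered/(_ b) => [g ->].
exists (g * ('X - (a i *: 'X)%:P) ^+ ((k + mdeg b) * mult i - mdeg b - k)).
rewrite -mulrA -exprD subnK //; move: mi; nia.
Qed.

End LinearChange.

(** * The supremum of the ratios *)

Section Supremum.
Local Open Scope classical_set_scope.
Import Order.TTheory Num.Theory.

Lemma ereal_sup_ratio_lt (R : realType) (X : nat -> nat -> Prop) :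
  (forall m r, X m r -> (m < r)%N) -> (forall m, (0 < m)%N -> X m m.+1) ->
  ereal_sup [set x : \bar R | exists m r : nat,
    [/\ (0 < m)%N, (0 < r)%N, X m r & x = (m%:R / r%:R)%:E]] = 1%:E.
Proof.
move=> X_lt X_succ; apply/eqP; rewrite eq_le; apply/andP; split.
  apply: ge_ereal_sup => _ [m [r [_ r0 /X_lt lt_mr ->]]].
  by rewrite lee_fin ler_pdivrMr ?ltr0n // mul1r ler_nat ltnW.
set s := ereal_sup _.
have le_s m : (0 < m)%N -> ((m%:R / m.+1%:R)%:E <= s)%E.
  move=> m0; apply: ereal_sup_ubound; exists m, m.+1.
  by split=> //; apply: X_succ.
case: s le_s => [y| |] le_s; [|by rewrite leey|by have := le_s 1%N isT].
rewrite lee_fin leNgt; apply/negP => y1.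
have y1' : 0 < 1 - y by rewrite subr_gt0.
(* With m > 1/(1 - y), the ratio m/(m + 1) = 1 - 1/(m + 1) exceeds y. *)
pose m := (Num.bound (1 - y)^-1).+1.
have := le_s m isT; rewrite lee_fin ler_pdivrMr ?ltr0n //; apply/negP.
have := archi_boundP (ltW (etrans (invr_gt0 _) y1')).
rewrite -{1}div1r ltr_pdivrMr // -ltNge /m.
rewrite -[_.+2]addn2 -[(Num.bound _).+1]addn1 !natrD.
by set b := (Num.bound _)%:R; lra.
Qed.

End Supremum.

End CollinearFatPoints.

Theorem theorem1p5 (R : realType) (K : closedFieldType) (N : nat)
    (hN : (2 <= N)%N) (n : nat) (P : 'I_n -> ppoint K N) (mult : 'I_n -> nat)
    (distinctP : injective P) (collinearP : collinear P)
    (mult_neq0 : exists i : 'I_n, mult i <> 0%N) :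
  (forall m : nat, fat_symbolic P mult m = ideal_pow (fat_ideal P mult) m) /\
  resurgence R P mult = 1%:E.
Proof.
have [u [w [a [l0 [l1 [inj_a Pa [l0u l0w] [l1u l1w]]]]]]] :=
  collinear_coordinates distinctP collinearP.
have symE := fat_symbolicE inj_a Pa l0u l0w l1u l1w mult.
split=> //; apply: ereal_sup_ratio_lt => [m r|m _]; rewrite symE.
  (* If r <= m, then I(Z)^m lies in I(Z)^r, so a failure of containment forces m < r. *)
  by move=> not_sub; rewrite ltnNge; apply/negP => /ideal_pow_le /not_sub.
apply: (fat_ideal_pow_neq Pa l0u l0w l1u l1w mult_neq0).
Qed.
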